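(* Let $k,l,m$ be positive integers, $n=(l+1)k$, and let $A\in\mathbb{R}^{m\times n}$ have $2k$-restricted isometry constant $\delta_{2k}\in[\frac{\sqrt{2}}{2},1)$. Let $x\in\mathbb{R}^n$, $\epsilon\ge 0$, $e\in\mathbb{R}^m$ with $\|e\|_2\le\epsilon$, and $y=Ax+e$. For $p\in(0,1)$ let $x^{\star}$ be a solution of $$\min_{\gamma\in\mathbb{R}^n}\|\gamma\|_p\quad\text{subject to}\quad \|y-A\gamma\|_2\le\epsilon .$$ Let $T_0=\{1,\dots,k\}$ and $T_0^c=\{k+1,\dots,n\}$. Then for each $p\in(0,1)$ such that $C(p)<1$, where $$C(p)=\begin{cases}\left(\dfrac{\big((2-\delta_{2k})^{1-\frac{2}{p}}+2\delta_{2k}\big)g(p)}{1-\delta_{2k}}\right)^{p/2}, & p\in(0,p^{\star}],\\[2ex] \left(\dfrac{(2-\delta_{2k})^{1-\frac{2}{p}}g(p)+2^{2-\frac{2}{p}}\delta_{2k}}{1-\delta_{2k}}\right)^{p/2}, & p\in(p^{\star},1),\end{cases}$$ the solution $x^{\star}$ obeys $$\|x-x^{\star}\|_p^p\le C_0\|x_{T_0^c}\|_p^p+C_1k^{1-\frac{p}{2}}\epsilon^p,\qquad C_0=\frac{2(1+C(p))}{1-C(p)},\quad C_1=\frac{2^{\frac{3p}{2}+1}}{(1-\delta_{2k})^{\frac{p}{2}}(1-C(p))}.$$ In particular, if $\epsilon=0$ and $x$ is $k$-sparse, then $x^{\star}=x$.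
   Context: For $1\le s\le n$, the $s$-restricted isometry constant $\delta_s$ of $A$ is the smallest constant such that $(1-\delta_s)\|z\|_2^2\le\|Az\|_2^2\le(1+\delta_s)\|z\|_2^2$ for all $s$-sparse $z\in\mathbb{R}^n$ (i.e. with at most $s$ nonzero entries). For $p\in(0,1)$, $\|\gamma\|_p=(\sum_i|\gamma_i|^p)^{1/p}$. For a vector $v$ and index set $T$, $v_T$ denotes the vector equal to $v$ on $T$ and zero elsewhere. $g(p)=\frac{p}{2}(1-\frac{p}{2})^{\frac{2}{p}-1}$ for $p\in(0,1]$. $p^{\star}\approx 0.45418$ is the unique solution in $(0,1]$ of $f(p)=1$, where $f(p)=(\frac{p}{2})^{1/2}(2-p)^{\frac1p-\frac12}$. *)

(* Defs.v *)
From HB Require Import structures.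
From mathcomp Require Import all_boot all_order all_algebra.
From mathcomp Require Import reals exp.
Set Implicit Arguments. Unset Strict Implicit. Unset Printing Implicit Defensive.
Import Order.TTheory GRing.Theory Num.Theory.
Local Open Scope ring_scope.

Section Defs.
Variable R : realType.

Definition l2norm (n : nat) (v : 'cV[R]_n) : R := Num.sqrt (\sum_i (v i ord0) ^+ 2).

Definition lp_pow (p : R) (n : nat) (v : 'cV[R]_n) : R := \sum_i `|v i ord0| `^ p.

Definition lpnorm (p : R) (n : nat) (v : 'cV[R]_n) : R := (lp_pow p v) `^ (p^-1).

Definition sparse (s n : nat) (z : 'cV[R]_n) : Prop := (#|[set i | z i ord0 != (0%R : R)]| <= s)%N.

Definition RIP_holds (m n : nat) (A : 'M[R]_(m, n)) (s : nat) (d : R) : Prop :=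
  forall z : 'cV[R]_n, sparse s z ->
    (1 - d) * (l2norm z) ^+ 2 <= (l2norm (A *m z)) ^+ 2 /\
    (l2norm (A *m z)) ^+ 2 <= (1 + d) * (l2norm z) ^+ 2.

Definition is_RIC (m n : nat) (A : 'M[R]_(m, n)) (s : nat) (d : R) : Prop :=
  RIP_holds A s d /\ (forall d', RIP_holds A s d' -> d <= d').

(* v_T for T = {k+1,...,n} (1-based), i.e. 0-based indices i >= k *)
Definition restr_tail (k n : nat) (v : 'cV[R]_n) : 'cV[R]_n :=
  \col_i (if (k <= i)%N then v i ord0 else 0).

Definition gfun (p : R) : R := p / 2 * (1 - p / 2) `^ (2 / p - 1).

Definition ffun_p (p : R) : R := (p / 2) `^ (2^-1) * (2 - p) `^ (p^-1 - 2^-1).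

Definition Cconst (pstar delta p : R) : R :=
  if p <= pstar then
    (((2 - delta) `^ (1 - 2 / p) + 2 * delta) * gfun p / (1 - delta)) `^ (p / 2)
  else
    (((2 - delta) `^ (1 - 2 / p) * gfun p + 2 `^ (2 - 2 / p) * delta) / (1 - delta)) `^ (p / 2).

Definition is_lp_minimizer (m n : nat) (p eps : R) (A : 'M[R]_(m, n)) (y : 'cV[R]_m)
  (xs : 'cV[R]_n) : Prop :=
  l2norm (y - A *m xs) <= eps /\
  forall g : 'cV[R]_n, l2norm (y - A *m g) <= eps -> lpnorm p xs <= lpnorm p g.

End Defs.

(* Main.v *)
(* With h = x - x*, order the complement of T by decreasing |h_i| and cut it into
   blocks of size k, with p-masses Q_0 >= Q_1 >= ... summing to P and l2 norms N_j,
   and let v be the part of h on all these blocks but the first.  Comparing each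
   entry with the mean over the previous block gives
   N_{j+1}^2 <= k^(1-2/p) Q_j^(2/p-1) Q_{j+1}, and polarization of the restricted
   isometry property gives |A v|^2 <= S + delta G with S = sum_{j>=1} N_j^2 and
   G = (sum_{j>=1} N_j)^2.  As gfun p is the maximum over u in [0,1] of
   u^(2/p-1) (1-u), both S - (1-delta) N_0^2 and G are bounded by multiples of
   k^(1-2/p) P^(2/p), the latter with the constant 2 max(gfun p, 2^(1-2/p));
   pstar is where the two terms of this maximum cross.  Since delta >= 1/2 the
   bound b obtained for |A v|^2 - (1-delta) N_0^2 also satisfies |A v|^2 <= 2 b,
   so the noise |A h| enters only additively:
   (1-delta) |h_T|_2^2 <= (sqrt 2 |A h| + sqrt b)^2.
   Subadditivity of t^p and the cone condition given by the minimality of x*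
   conclude.  The exact recovery statement uses any T of size k containing the
   support of x. *)
Require Import Defs.
From HB Require Import structures.
From mathcomp Require Import all_boot all_order all_algebra.
From mathcomp Require Import reals exp.
From mathcomp Require Import ring lra.
Import Order.TTheory GRing.Theory Num.Theory.
Local Open Scope ring_scope.
Set Implicit Arguments. Unset Strict Implicit.

(** * Inequalities for real powers and finite sums *)

Section RealInequalities.
Variable R : realType.
Implicit Types (a b t u w p P Q : R).

Lemma powRV a t : 0 <= a -> a^-1 `^ t = a `^ (- t).
Proof. by move=> a0; rewrite -[a^-1]powR_inv1// -powRrM mulN1r. Qed.

(** Young's inequality for the conjugate exponents 1/t and 1/(1-t), applied to a^t and b^(1-t). *)
Lemma young_powR t a b : 0 < t < 1 -> 0 <= a -> 0 <= b ->
  a `^ t * b `^ (1 - t) <= t * a + (1 - t) * b.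
Proof.
move=> /andP[t0 t1] a0 b0.
have t1' : 0 < 1 - t by rewrite subr_gt0.
have tp : 0 < t^-1 by rewrite invr_gt0.
have tq : 0 < (1 - t)^-1 by rewrite invr_gt0.
have E : t^-1^-1 + (1 - t)^-1^-1 = 1 by rewrite !invrK addrC subrK.
have := @conjugate_powR R (a `^ t) (b `^ (1 - t)) _ _ (powR_ge0 _ _) (powR_ge0 _ _)
  tp tq E.
by rewrite -!powRrM !divff ?gt_eqF// !powRr1// !invrK [a * t]mulrC [b * _]mulrC.
Qed.

Lemma powRD_le p a b : 0 < p -> p <= 1 -> 0 <= a -> 0 <= b ->
  (a + b) `^ p <= a `^ p + b `^ p.
Proof.
move=> p0 p1 a0 b0.
have [s0|sN] := eqVneq (a + b) 0.
  by rewrite s0 powR0 ?gt_eqF// addr_ge0// powR_ge0.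
have s0 : 0 < a + b by rewrite lt_def sN addr_ge0.
(* A share c/(a+b) lies in [0,1], so it is at most its own p-th power; the shares of [a] and [b] add
   up to 1. *)
have H c : 0 <= c -> c <= a + b -> c / (a + b) * (a + b) `^ p <= c `^ p.
  move=> c0 cs; have [->|cN] := eqVneq c 0.
    by rewrite mul0r mul0r powR_ge0.
  have cp : 0 < c by rewrite lt_def cN.
  have -> : c `^ p = (c / (a + b)) `^ p * (a + b) `^ p.
    by rewrite -powRM ?divr_ge0 ?(ltW s0)// divfK.
  by rewrite ler_wpM2r ?powR_ge0// ger1_powR// divr_gt0//= ler_pdivrMr// mul1r.
rewrite (le_trans _ (lerD (H a a0 _) (H b b0 _))) ?lerDl ?lerDr//.
by rewrite -mulrDl -mulrDl divff// mul1r.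
Qed.

Lemma gfun_gt0 p : 0 < p -> p < 2 -> 0 < gfun p.
Proof. by move=> p0 p2; rewrite /gfun mulr_gt0 ?powR_gt0//; lra. Qed.

(** The maximum is attained at u = 1 - s with s = p/2. Weighted Young, normalised at that point,
    gives (u/(1-s))^(1-s) ((1-u)/s)^s <= 1; raising this to the power 1/s gives the claim. *)
Lemma gfun_max p u : 0 < p -> p < 2 -> 0 <= u <= 1 ->
  u `^ (2 / p - 1) * (1 - u) <= gfun p.
Proof.
move=> p0 p2 /andP[u0 u1].
have [s sE] : exists s, s = p / 2 by exists (p / 2).
have s0 : 0 < s by lra.
have s1 : 0 < 1 - s by lra.
have u1' : 0 <= 1 - u by lra.
have ts : 0 < 1 - s < 1 by lra.
have := young_powR ts (divr_ge0 u0 (ltW s1)) (divr_ge0 u1' (ltW s0)).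
have -> : (1 - s) * (u / (1 - s)) + (1 - (1 - s)) * ((1 - u) / s) = 1.
  by field; rewrite ?gt_eqF.
have -> : 1 - (1 - s) = s by ring.
have s2 : 0 <= s^-1 by rewrite invr_ge0 ltW.
move=> /(ge0_ler_powR s2); rewrite powR1 !nnegrE mulr_ge0 ?powR_ge0// => /(_ isT ler01).
rewrite powRM ?powR_ge0// -!powRrM divff ?gt_eqF// powRr1 ?divr_ge0 ?(ltW s0)//.
have -> : (1 - s) * s^-1 = 2 / p - 1 by rewrite sE; field; rewrite gt_eqF.
move=> H.
have -> : u `^ (2 / p - 1) * (1 - u)
   = (u / (1 - s)) `^ (2 / p - 1) * ((1 - u) / s) * gfun p.
  have -> : u `^ (2 / p - 1) = (u / (1 - s)) `^ (2 / p - 1) * (1 - s) `^ (2 / p - 1).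
    by rewrite -powRM ?divr_ge0 ?(ltW s1)// divfK ?gt_eqF.
  by rewrite /gfun -sE; field; rewrite gt_eqF.
by rewrite ler_piMl// ltW// gfun_gt0.
Qed.

(** Homogeneous form of [gfun_max], with u = wQ/P. If wQ > P or P = 0, the left side is at most
    0. *)
Lemma gfun_max_hom p w P Q : 0 < p -> p < 2 -> 0 < w -> 0 <= P -> 0 <= Q ->
  Q `^ (2 / p - 1) * (P - w * Q) <= w `^ (1 - 2 / p) * gfun p * P `^ (2 / p).
Proof.
move=> p0 p2 w0 P0 Q0.
have g0 := ltW (gfun_gt0 p0 p2).
have R0 : 0 <= w `^ (1 - 2 / p) * gfun p * P `^ (2 / p).
  by rewrite mulr_ge0 ?powR_ge0// mulr_ge0 ?powR_ge0.
have [wQP|PwQ] := lerP (w * Q) P; last first.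
  by apply: le_trans R0; rewrite mulr_ge0_le0 ?powR_ge0// subr_le0 ltW.
have [PE|PN] := eqVneq P 0.
  apply: le_trans R0; rewrite PE in wQP *.
  by rewrite mulr_ge0_le0 ?powR_ge0// sub0r oppr_le0 mulr_ge0// ltW.
have Pp : 0 < P by rewrite lt_def PN.
have u01 : 0 <= w * Q / P <= 1.
  by rewrite divr_ge0 ?mulr_ge0 ?(ltW w0) ?(ltW Pp)//= ler_pdivrMr// mul1r.
have := gfun_max p0 p2 u01.
have [q qE] : exists q, q = 2 / p - 1 by exists (2 / p - 1).
rewrite -qE => H.
have -> : 1 - 2 / p = - q by rewrite qE; ring.
have -> : 2 / p = q + 1 by rewrite qE; ring.
have -> : Q `^ q * (P - w * Q)
    = w `^ (- q) * ((w * Q / P) `^ q * (1 - w * Q / P)) * P `^ (q + 1).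
  rewrite [P `^ (q + 1)]powRD ?PN ?implybT// powRr1 ?(ltW Pp)// powRN.
  have E : (w * Q / P) `^ q * P `^ q = w `^ q * Q `^ q.
    rewrite -powRM ?(ltW Pp) ?(andP u01).1// divfK// powRM//.
    exact: ltW.
  have wq : w `^ q != 0 by rewrite gt_eqF// powR_gt0.
  have -> : Q `^ q = (w `^ q)^-1 * ((w * Q / P) `^ q * P `^ q).
    by rewrite E mulKf.
  by field; rewrite PN.
by rewrite ler_wpM2r ?powR_ge0// ler_wpM2l ?powR_ge0.
Qed.

(** Since 1 - p/2 = (2-p)/2, this identity says that [gfun p] is 2^(1-2/p) times the square of
    [ffun_p p]: the equation [ffun_p p = 1] is the crossing of the two terms of the maximum. *)
Lemma ffun_p_sqr p : 0 < p -> p < 2 ->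
  ffun_p p ^+ 2 = p / 2 * (2 - p) `^ (2 / p - 1).
Proof.
move=> p0 p2; rewrite /ffun_p exprMn -!powR_mulrn ?powR_ge0// -!powRrM.
rewrite mulVf ?pnatr_eq0// powRr1; last by rewrite divr_ge0// ltW.
by congr (_ * _ `^ _); field; rewrite gt_eqF.
Qed.

(** No monotonicity of [ffun_p] is required: [gfun_max] for [p] is tested at 1 - s/2, the maximiser
    for [s]. As 2 - s >= 1 and 2/p >= 2/s, passing from exponent 2/s - 1 to 2/p - 1 only increases
    the power of 2 - s. *)
Lemma gfun_ge_of_ffun_p_eq1 p s : 0 < p -> p <= s -> s <= 1 -> ffun_p s = 1 ->
  2 `^ (1 - 2 / p) <= gfun p.
Proof.
move=> p0 ps s1 fs.
have s0 : 0 < s by lra.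
have s2 : s < 2 by lra.
have := ffun_p_sqr s0 s2; rewrite fs expr1n => E.
have u01 : 0 <= 1 - s / 2 <= 1 by lra.
have p2 : p < 2 by lra.
apply: le_trans (gfun_max p0 p2 u01).
have -> : 1 - (1 - s / 2) = s / 2 by ring.
have -> : 1 - s / 2 = 2^-1 * (2 - s) by field.
rewrite powRM ?invr_ge0//; last by lra.
rewrite powRV// opprB -mulrA ler_peMr ?powR_ge0//.
rewrite mulrC [X in X <= _]E ler_pM2l ?divr_gt0// ler_powR//; first by lra.
by rewrite lerB// ler_pM2l// lef_pV2.
Qed.

(** The same argument with the roles exchanged: [gfun_max] for [s] is tested at 1 - p/2, the
    maximiser for [p]. *)
Lemma gfun_le_of_ffun_p_eq1 p s : 0 < s -> s <= p -> p <= 1 -> ffun_p s = 1 ->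
  gfun p <= 2 `^ (1 - 2 / p).
Proof.
move=> s0 sp p1 fs.
have p0 : 0 < p by lra.
have s2 : s < 2 by lra.
have := ffun_p_sqr s0 s2; rewrite fs expr1n => E.
have u01 : 0 <= 1 - p / 2 <= 1 by lra.
have h t : 1 - t / 2 = 2^-1 * (2 - t) by field.
have gs : gfun s = 2^-1 `^ (2 / s - 1).
  by rewrite /gfun h powRM ?invr_ge0 ?subr_ge0 ?(ltW s2)// mulrCA -E mulr1.
have p2 : 0 <= 2 - p by lra.
have := gfun_max s0 s2 u01; rewrite gs.
have -> : 1 - (1 - p / 2) = p / 2 by ring.
rewrite h powRM ?invr_ge0// -mulrA ger_pMr ?powR_gt0 ?invr_gt0// => H.
rewrite /gfun h powRM ?invr_ge0// mulrCA.
have -> : 2 `^ (1 - 2 / p) = 2^-1 `^ (2 / p - 1) :> R by rewrite powRV// opprB.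
rewrite ler_piMr ?powR_ge0//.
apply: le_trans H; rewrite mulrC ler_wpM2r//; first by lra.
rewrite ler_powR//; first by lra.
by rewrite lerB// ler_pM2l// lef_pV2.
Qed.

(** A Hölder inequality, obtained by applying Young to each square a_i^2 against their mean [c];
    summing over [T] turns the right side into [W]. *)
Lemma sum_powR_le (I : finType) (T : {set I}) p (a : I -> R) :
  0 < p -> p < 2 -> (forall i, 0 <= a i) ->
  \sum_(i in T) a i `^ p
    <= #|T|%:R `^ (1 - p / 2) * (\sum_(i in T) a i ^+ 2) `^ (p / 2).
Proof.
move=> p0 p2 a0; set W := \sum_(i in T) a i ^+ 2.
have W0 : 0 <= W by apply: sumr_ge0 => i _; exact: sqr_ge0.
have [/eqP WE|WN] := eqVneq W 0.
  rewrite (eq_bigr (fun=> 0)) ?sumr_const ?mul0rn ?mulr_ge0 ?powR_ge0// => i iT.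
  move: WE; rewrite psumr_eq0 => [|j _]; last exact: sqr_ge0.
  by move=> /allP/(_ i (mem_index_enum _)); rewrite iT sqrf_eq0 => /eqP->; rewrite powR0 ?gt_eqF.
have Wp : 0 < W by rewrite lt_def WN.
have k0 : 0 < #|T|%:R :> R.
  rewrite ltr0n card_gt0; apply: contra_neq WN => TE.
  by rewrite /W TE big_set0.
have t01 : 0 < p / 2 < 1 by lra.
set c := W / #|T|%:R.
have c0 : 0 < c by rewrite divr_gt0.
have H : (\sum_(i in T) a i `^ p) * c `^ (1 - p / 2) <= W.
  have {1}-> : W = \sum_(i in T) (p / 2 * a i ^+ 2 + (1 - p / 2) * c).
    rewrite big_split/= -mulr_sumr -/W sumr_const -[_ *+ #|T|]mulr_natl /c.
    by field; rewrite gt_eqF.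
  rewrite mulr_suml; apply: ler_sum => i _.
  have -> : a i `^ p = (a i ^+ 2) `^ (p / 2).
    by rewrite -powR_mulrn// -powRrM; congr (_ `^ _); field.
  by apply: young_powR => //; [exact: sqr_ge0 | exact: ltW].
rewrite -(@ler_pM2r _ (c `^ (1 - p / 2))) ?powR_gt0// (le_trans H)//.
have kc : #|T|%:R * c = W by rewrite mulrC divfK ?gt_eqF.
rewrite mulrAC -powRM ?(ltW k0) ?(ltW c0)// kc.
by rewrite -powRD ?WN ?implybT// subrK powRr1.
Qed.

Lemma cauchy_schwarz_sum (I : Type) (r : seq I) (x y : I -> R) :
  (\sum_(i <- r) x i * y i) ^+ 2
    <= (\sum_(i <- r) x i ^+ 2) * (\sum_(i <- r) y i ^+ 2).
Proof.
set X := \sum_(i <- r) x i ^+ 2; set Y := \sum_(i <- r) y i ^+ 2.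
set Z := \sum_(i <- r) x i * y i.
have X0 : 0 <= X by apply: sumr_ge0 => i _; exact: sqr_ge0.
have Y0 : 0 <= Y by apply: sumr_ge0 => i _; exact: sqr_ge0.
have H s t : 0 <= s ^+ 2 * X + 2 * (s * t) * Z + t ^+ 2 * Y.
  rewrite !mulr_sumr -!big_split/=; apply: sumr_ge0 => i _.
  suff -> : s ^+ 2 * x i ^+ 2 + 2 * (s * t) * (x i * y i) + t ^+ 2 * y i ^+ 2
    = (s * x i + t * y i) ^+ 2 by exact: sqr_ge0.
  by ring.
have [YE|YN] := eqVneq Y 0.
  (* With Y = 0 the quadratic form at this point equals -(X+2) Z^2, which forces Z = 0. *)
  have := H (- Z) (X + 1); rewrite YE !mulr0 addr0.
  have [->|ZN] := eqVneq Z 0; first by rewrite expr0n.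
  have : 0 < Z ^+ 2 by rewrite exprn_even_gt0.
  nra.
have Yp : 0 < Y by rewrite lt_def YN.
(* The minimiser of the form, up to scaling. *)
have := H Y (- Z).
have -> : Y ^+ 2 * X + 2 * (Y * - Z) * Z + (- Z) ^+ 2 * Y = Y * (X * Y - Z ^+ 2).
  by ring.
by rewrite pmulr_rge0// subr_ge0.
Qed.

(** Cauchy-Schwarz for the square roots of X_i and Y_i, which dominate N_i through their product. *)
Lemma sum_geom_le (I : Type) (r : seq I) (N X Y : I -> R) :
  (forall i, 0 <= N i) -> (forall i, 0 <= X i) -> (forall i, 0 <= Y i) ->
  (forall i, N i ^+ 2 <= X i * Y i) ->
  (\sum_(i <- r) N i) ^+ 2 <= (\sum_(i <- r) X i) * (\sum_(i <- r) Y i).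
Proof.
move=> N0 X0 Y0 NXY.
have := cauchy_schwarz_sum r (fun i => Num.sqrt (X i)) (fun i => Num.sqrt (Y i)).
have E (Z : I -> R) : (forall i, 0 <= Z i) ->
    \sum_(i <- r) Num.sqrt (Z i) ^+ 2 = \sum_(i <- r) Z i.
  by move=> Z0; apply: eq_bigr => i _; rewrite sqr_sqrtr.
rewrite (E X)// (E Y)//.
apply: le_trans.
rewrite ler_sqr ?nnegrE ?sumr_ge0// => [|i _]; last by rewrite mulr_ge0 ?sqrtr_ge0.
by apply: ler_sum => i _; rewrite -sqrtrM// -[N i]ger0_norm// -sqrtr_sqr ler_wsqrtr.
Qed.

(** * Sums over blocks in terms of their masses [Q] and l2 norms [N]; [kap] stands for k^(1-2/p) *)

Section BlockSums.
Variables (l : nat) (p kap : R) (N Q : nat -> R).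
Hypotheses (p0 : 0 < p) (p1 : p < 1) (kap0 : 0 <= kap).
Hypotheses (N0 : forall j, 0 <= N j) (Q0 : forall j, 0 <= Q j).
Hypothesis Qdec : forall j, (j < l)%N -> Q j.+1 <= Q j.
Let q := 2 / p - 1.
Hypothesis NQ : forall j, (j < l)%N ->
  N j.+1 ^+ 2 <= kap * Q j `^ q * Q j.+1.
Let P := \sum_(j < l.+1) Q j.

Lemma q_ge1 : 1 <= q.
Proof. by rewrite lerBrDr ler_pdivlMr//; have := p1; lra. Qed.

Lemma Q_le_head j : (j <= l)%N -> Q j <= Q 0.
Proof. by elim: j => // j IH jl; rewrite (le_trans (Qdec jl))// IH// ltnW. Qed.

Lemma tail_sumE : \sum_(j < l) Q j.+1 = P - Q 0.
Proof. by rewrite /P big_ord_recl addrC addKr. Qed.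

Lemma sum_sqr_le : \sum_(j < l) N j.+1 ^+ 2 <= kap * Q 0 `^ q * (P - Q 0).
Proof.
rewrite -tail_sumE mulr_sumr; apply: ler_sum => j _.
apply: le_trans (NQ (ltn_ord j)) _.
rewrite ler_wpM2r// ler_wpM2l// ge0_ler_powR ?nnegrE//.
  by have := q_ge1; lra.
by rewrite Q_le_head// ltnW.
Qed.

(** The bound on N_{j+1}^2 is split as (kap Q_0^(q-1) Q_j) Q_{j+1}, so that [sum_geom_le] yields a
    product of two sums of masses. Replacing Q_j^(q-1) by Q_0^(q-1) relies on q >= 1. *)
Lemma sqr_sum_le :
  (\sum_(j < l) N j.+1) ^+ 2 <= kap * Q 0 `^ (q - 1) * P * (P - Q 0).
Proof.
pose X (j : 'I_l) := kap * Q 0 `^ (q - 1) * Q j.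
have X0 j : 0 <= X j by rewrite mulr_ge0// mulr_ge0// powR_ge0.
have := @sum_geom_le _ (index_enum 'I_l) (fun j => N j.+1) X (fun j => Q j.+1).
rewrite tail_sumE => /(_ (fun=> N0 _) X0 (fun=> Q0 _)) H.
apply: le_trans (H _) _ => [j|].
  apply: le_trans (NQ (ltn_ord j)) _.
  rewrite /X ler_wpM2r// -mulrA ler_wpM2l//.
  have {1}-> : q = q - 1 + 1 by rewrite subrK.
  have q1 := q_ge1.
  rewrite powRD; last by rewrite subrK gt_eqF//; lra.
  rewrite powRr1// ler_wpM2r// ge0_ler_powR ?nnegrE ?Q_le_head//.
    by rewrite subr_ge0.
  exact: ltnW.
have PQ : 0 <= P - Q 0 by rewrite -tail_sumE; exact: sumr_ge0.
rewrite ler_wpM2r//.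
rewrite -mulr_sumr ler_wpM2l ?mulr_ge0 ?powR_ge0//.
by rewrite /P big_ord_recr/= lerDl.
Qed.

(* If the first block carries at most half of the mass, bound its power by
   that of [P / 2]; otherwise [P <= 2 Q_0] reduces the claim to [gfun_max_hom]. *)
Lemma sqr_sum_le_max M : gfun p <= M -> 2 `^ (1 - 2 / p) <= M ->
  (\sum_(j < l) N j.+1) ^+ 2 <= kap * (2 * M) * P `^ (2 / p).
Proof.
move=> gM tM; apply: le_trans sqr_sum_le _.
have q1 := q_ge1.
have P0 : 0 <= P by exact: sumr_ge0.
have PQ : 0 <= P - Q 0 by rewrite -tail_sumE; exact: sumr_ge0.
have M0 : 0 <= M by apply: le_trans tM; exact: powR_ge0.
rewrite -!mulrA ler_wpM2l//.
have [h|h] := lerP (Q 0) (P / 2).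
  have -> : P `^ (2 / p) = P `^ (q - 1) * (P * P).
    rewrite -[P * P]expr2 -powR_mulrn// -powRD; first by congr (_ `^ _); rewrite /q; ring.
    by have -> : q - 1 + 2 = 2 / p by [rewrite /q; ring]; rewrite gt_eqF// divr_gt0.
  (* Halving [P] costs the factor 2^(1-q) = 2 * 2^(1-2/p), which is at most 2M. *)
  have H1 : Q 0 `^ (q - 1) <= P `^ (q - 1) * (2 * M).
    apply: (@le_trans _ _ ((P / 2) `^ (q - 1))).
      by rewrite ge0_ler_powR ?nnegrE ?divr_ge0// subr_ge0.
    rewrite powRM ?invr_ge0// ler_wpM2l ?powR_ge0// powRV//.
    apply: (@le_trans _ _ (2 * 2 `^ (1 - 2 / p))); last by rewrite ler_wpM2l.
    rewrite -{2}[2]powRr1// -powRD ?pnatr_eq0 ?implybT//.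
    by rewrite le_eqVlt; apply/orP; left; apply/eqP; congr (_ `^ _); rewrite /q; ring.
  have H2 : P * (P - Q 0) <= P * P by rewrite ler_wpM2l// lerBlDr lerDl.
  apply: le_trans (ler_pM (powR_ge0 _ _) _ H1 H2) _; first by rewrite mulr_ge0.
  by rewrite le_eqVlt; apply/orP; left; apply/eqP; ring.
have p2 : p < 2 by apply: lt_trans p1 _; rewrite ltr1n.
have := gfun_max_hom p0 p2 ltr01 P0 (Q0 0).
rewrite powR1 !mul1r -/q => H.
have -> : 2 * (M * P `^ (2 / p)) = 2 * M * P `^ (2 / p) by rewrite mulrA.
apply: (@le_trans _ _ (2 * (Q 0 `^ q * (P - Q 0)))); last first.
  rewrite -mulrA ler_wpM2l// (le_trans H)// ler_wpM2r// powR_ge0//.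
have {2}-> : q = q - 1 + 1 by rewrite subrK.
rewrite [X in _ <= 2 * (X * _)]powRD; last by rewrite subrK gt_eqF//; lra.
rewrite powRr1// !mulrA ler_wpM2r// -mulrA mulrCA ler_wpM2l ?powR_ge0//.
lra.
Qed.

End BlockSums.

(** In use [a] is the noise |A h|, [b] bounds |A v|, and [c] is the share of the first block. The
    third bound gives b <= sqrt 2 sqrt T, so the factor sqrt 2 on [a] makes 2ab fit under the cross
    term of the final square. *)
Lemma noise_split a b c H T : 0 <= a -> 0 <= b -> 0 <= T ->
  H + c <= (a + b) ^+ 2 -> b ^+ 2 - c <= T -> b ^+ 2 <= 2 * T ->
  H <= (Num.sqrt 2 * a + Num.sqrt T) ^+ 2.
Proof.
move=> a0 b0 T0 H1 H2 H3.
have sT := sqr_sqrtr T0; have s2 : Num.sqrt 2 ^+ 2 = 2 :> R by rewrite sqr_sqrtr.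
have bs : b <= Num.sqrt 2 * Num.sqrt T.
  by rewrite -sqrtrM// -[b]ger0_norm// -sqrtr_sqr ler_wsqrtr.
have : a * b <= a * (Num.sqrt 2 * Num.sqrt T) by rewrite ler_wpM2l.
have -> : (Num.sqrt 2 * a + Num.sqrt T) ^+ 2
    = Num.sqrt 2 ^+ 2 * a ^+ 2 + 2 * (a * (Num.sqrt 2 * Num.sqrt T)) + Num.sqrt T ^+ 2.
  by ring.
rewrite s2 sT.
have E : (a + b) ^+ 2 = a ^+ 2 + 2 * (a * b) + b ^+ 2 by ring.
by rewrite E in H1; have := sqr_ge0 a; lra.
Qed.

End RealInequalities.

(** * Blocks of decreasing entries *)

Section Blocks.

Lemma count_divn_iota k l j : (0 < k)%N -> (j < l)%N ->
  count (fun r => r %/ k == j)%N (iota 0 (l * k)) = k.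
Proof.
move=> k0; elim: l j => // l IH j.
rewrite ltnS mulSnr iotaD count_cat add0n => jl.
(* The last [k] ranks all have quotient [l]. *)
have Eb c : count (fun r => r %/ k == c)%N (iota (l * k) k) = if c == l then k else 0%N.
  transitivity (count (fun=> c == l) (iota (l * k) k)).
    apply: eq_in_count => r; rewrite mem_iota => /andP[h1 h2].
    rewrite -[r](subnKC h1) divnMDl// divn_small ?addn0 1?eq_sym//.
    by rewrite ltn_subLR.
  by case: (c == l); rewrite ?count_predT ?count_pred0 ?size_iota.
rewrite Eb; move: jl; rewrite leq_eqVlt => /orP[/eqP->|jl].
  rewrite eqxx; suff -> : count (fun r => r %/ k == l)%N (iota 0 (l * k)) = 0%N by [].
  apply/eqP; rewrite -leqn0 leqNgt -has_count; apply/hasPn => r.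
  by rewrite mem_iota add0n /= => h; rewrite neq_ltn ltn_divLR// h.
by rewrite IH// ltn_eqF// addn0.
Qed.

(** Sort [T] by decreasing [f] and let the block of an element be its rank divided by [k]. *)
Lemma exists_block_order (R : realDomainType) (I : finType) (T : {set I}) (k l : nat)
    (f : I -> R) : (0 < k)%N -> #|T| = (l * k)%N ->
  exists b : I -> nat,
    [/\ forall i, i \in T -> (b i < l)%N,
        forall j, (j < l)%N -> #|[set i in T | b i == j]| = k &
        forall i i', i \in T -> i' \in T -> (b i < b i')%N -> f i' <= f i].
Proof.
move=> k0 cT; pose r := fun i i' => f i' <= f i.
pose s := sort r (enum T).
have us : uniq s by rewrite sort_uniq enum_uniq.
have ms i : (i \in s) = (i \in T) by rewrite mem_sort mem_enum.
have ss : size s = (l * k)%N by rewrite size_sort -cardE.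
have rtot : total r by move=> i i'; rewrite /r; exact: le_total.
have rtr : transitive r by move=> i i' i'' h1 h2; exact: le_trans h2 h1.
have srt : sorted r s by exact: sort_sorted.
exists (fun i => index i s %/ k)%N; split.
- by move=> i; rewrite -ms => iT; rewrite ltn_divLR// -ss index_mem.
- move=> j jl; rewrite -[RHS](count_divn_iota k0 jl) -ss.
  (* The ranks of the elements of [s] are 0, 1, ..., so counting a block becomes counting
     quotients. *)
  have <- : [seq index i s | i <- s] = iota 0 (size s).
    case: (s) us => [|x0 s'] us'//.
    apply: (@eq_from_nth _ 0%N); first by rewrite size_map size_iota.
    move=> i; rewrite size_map => i_s.
    by rewrite (nth_map x0)// index_uniq// nth_iota.
  rewrite count_map -size_filter cardE.
  apply/perm_size/uniq_perm; rewrite ?enum_uniq ?filter_uniq// => i.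
  by rewrite mem_enum inE mem_filter ms andbC.
- move=> i i'; rewrite -!ms => iT iT' lt.
  have lt' : (index i s < index i' s)%N.
    by rewrite ltnNge; apply: contraTN lt => h; rewrite -leqNgt leq_div2r.
  by have := @sorted_ltn_index _ _ rtr _ srt _ _ iT iT' lt'.
Qed.

Lemma exists_superset_card (I : finType) (S : {set I}) k :
  (#|S| <= k)%N -> (k <= #|I|)%N -> exists2 T : {set I}, S \subset T & #|T| = k.
Proof.
move=> Sk; elim: k Sk => [|k IH] Sk kI.
  by exists S => //; apply/eqP; rewrite -leqn0.
move: Sk; rewrite leq_eqVlt => /orP[/eqP<-|]; first by exists S.
rewrite ltnS => Sk; have [T ST cT] := IH Sk (ltnW kI).
have : (0 < #|~: T|)%N by rewrite -(ltn_add2l #|T|) cardsC addn0 cT.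
move=> /card_gt0P[i]; rewrite inE => iT; exists (i |: T).
  by apply: subset_trans ST _; exact: subsetU1.
by rewrite cardsU1 iT cT.
Qed.

End Blocks.

(** * The restricted isometry property *)

Section Vectors.
Variable R : realType.

Definition dot n (u v : 'cV[R]_n) : R := \sum_i u i ord0 * v i ord0.

Definition restr n (S : {set 'I_n}) (v : 'cV[R]_n) : 'cV[R]_n :=
  \col_i (if i \in S then v i ord0 else 0).

Lemma l2norm_ge0 n (v : 'cV[R]_n) : 0 <= l2norm v.
Proof. exact: sqrtr_ge0. Qed.

Lemma l2norm_sqr n (v : 'cV[R]_n) : l2norm v ^+ 2 = dot v v.
Proof.
rewrite sqr_sqrtr; last by apply: sumr_ge0 => i _; exact: sqr_ge0.
by apply: eq_bigr => i _; rewrite expr2.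
Qed.

Lemma dotC n (u v : 'cV[R]_n) : dot u v = dot v u.
Proof. by apply: eq_bigr => i _; rewrite mulrC. Qed.

Lemma dotDl n (u v w : 'cV[R]_n) : dot (u + v) w = dot u w + dot v w.
Proof. by rewrite -big_split; apply: eq_bigr => i _; rewrite mxE mulrDl. Qed.

Lemma dotZl n c (u v : 'cV[R]_n) : dot (c *: u) v = c * dot u v.
Proof. by rewrite mulr_sumr; apply: eq_bigr => i _; rewrite mxE mulrA. Qed.

Lemma dot_suml n (I : finType) (u : I -> 'cV[R]_n) v :
  dot (\sum_i u i) v = \sum_i dot (u i) v.
Proof.
rewrite exchange_big/=; apply: eq_bigr => i _.
by rewrite summxE mulr_suml.
Qed.

Lemma dot_comb n (a b : R) (u v : 'cV[R]_n) :
  dot (a *: u + b *: v) (a *: u + b *: v)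
    = a ^+ 2 * dot u u + 2 * (a * b) * dot u v + b ^+ 2 * dot v v.
Proof.
rewrite dotDl !dotZl ![dot _ (_ + _)]dotC !dotDl !dotZl (dotC v u).
by ring.
Qed.

Lemma l2normD_le n (u v : 'cV[R]_n) : l2norm (u + v) <= l2norm u + l2norm v.
Proof.
rewrite -ler_sqr ?nnegrE ?addr_ge0 ?l2norm_ge0//.
have := dot_comb 1 1 u v; rewrite !scale1r l2norm_sqr => ->.
rewrite sqrrD !l2norm_sqr expr1n !mul1r mulr1 lerD2r lerD2l -[leRHS]mulr_natl ler_wpM2l//.
rewrite (le_trans (ler_norm _))// -ler_sqr ?nnegrE ?mulr_ge0 ?l2norm_ge0//.
rewrite real_normK ?num_real// exprMn !l2norm_sqr /dot.
rewrite [X in _ <= X](_ : _ = (\sum_i u i ord0 ^+ 2) * (\sum_i v i ord0 ^+ 2)).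
  exact: cauchy_schwarz_sum.
by congr (_ * _); apply: eq_bigr => i _; rewrite expr2.
Qed.

Lemma l2normN n (v : 'cV[R]_n) : l2norm (- v) = l2norm v.
Proof. by congr Num.sqrt; apply: eq_bigr => i _; rewrite mxE sqrrN. Qed.

Lemma l2norm_eq0 n (v : 'cV[R]_n) : l2norm v = 0 -> v = 0.
Proof.
move=> v0; have := l2norm_sqr v; rewrite v0 expr0n/= => /esym/eqP.
rewrite psumr_eq0 => [/allP h|i _]; last by rewrite -expr2 sqr_ge0.
apply/matrixP => i j; rewrite ord1 mxE.
by have := h i (mem_index_enum _); rewrite -expr2 sqrf_eq0 => /eqP.
Qed.

Lemma sparse_restr n k (S : {set 'I_n}) (v : 'cV[R]_n) :
  (#|S| <= k)%N -> sparse k (restr S v).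
Proof.
apply: leq_trans; apply: subset_leq_card; apply/subsetP => i.
by rewrite inE mxE; case: ifP => //; rewrite eqxx.
Qed.

Lemma sparse_comb n k (a b : R) (u v : 'cV[R]_n) :
  sparse k u -> sparse k v -> sparse (2 * k) (a *: u + b *: v).
Proof.
move=> su sv; rewrite /sparse mul2n -addnn.
apply: leq_trans (leq_add su sv); apply: leq_trans (leq_card_setU _ _).
apply: subset_leq_card; apply/subsetP => i; rewrite !inE !mxE.
by apply: contraNT; rewrite negb_or !negbK => /andP[/eqP-> /eqP->]; rewrite !mulr0 addr0.
Qed.

Lemma l2norm_restr_sqr n (S : {set 'I_n}) (v : 'cV[R]_n) :
  l2norm (restr S v) ^+ 2 = \sum_(i in S) `|v i ord0| ^+ 2.
Proof.
rewrite l2norm_sqr [RHS]big_mkcond; apply: eq_bigr => i _; rewrite mxE.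
by case: ifP => _; rewrite ?mul0r// real_normK ?num_real// expr2.
Qed.

Lemma dot_restr_disjoint n (S T : {set 'I_n}) (v : 'cV[R]_n) :
  [disjoint S & T] -> dot (restr S v) (restr T v) = 0.
Proof.
move=> dST; apply: big1 => i _; rewrite !mxE.
by case: ifP => [iS|_]; rewrite ?mul0r// (disjointFr dST iS) mulr0.
Qed.

Section RIP.
Variables (m n k : nat) (A : 'M[R]_(m, n)) (d : R).
Hypothesis rip : RIP_holds A (2 * k) d.

(** Polarization with b u + a v and b u - a v: this scaling gives both the squared norm 2 a^2 b^2.
    The upper bound for the first minus the lower bound for the second is 4ab times the claim. *)
Lemma rip_dot_le (u v : 'cV[R]_n) : sparse k u -> sparse k v -> dot u v = 0 ->
  dot (A *m u) (A *m v) <= d * (l2norm u * l2norm v).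
Proof.
move=> su sv uv; set a := l2norm u; set b := l2norm v.
have [a0|aN] := eqVneq a 0.
  rewrite (l2norm_eq0 a0) mulmx0 a0 mul0r mulr0 /dot big1// => i _.
  by rewrite mxE mul0r.
have [b0|bN] := eqVneq b 0.
  rewrite (l2norm_eq0 b0) mulmx0 b0 !mulr0 /dot big1// => i _.
  by rewrite [X in _ * X]mxE mulr0.
have ab : 0 < a * b by rewrite mulr_gt0// lt_def ?aN ?bN l2norm_ge0.
have [_ hp] := rip (sparse_comb b a su sv).
have [hm _] := rip (sparse_comb b (- a) su sv).
move: hp hm; rewrite !mulmxDr -!scalemxAr !l2norm_sqr !dot_comb uv -!l2norm_sqr -/a -/b.
set D := dot _ _; set X := l2norm (A *m u); set Y := l2norm (A *m v) => hp hm.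
rewrite -(ler_pM2l ab); nra.
Qed.

(** In the expanded square, a diagonal term is at most (1+d) |u_i|^2. Its [d] part supplies the
    diagonal of the square of the sum of norms, whose other terms come from [rip_dot_le]. *)
Lemma rip_sum_le l (u : 'I_l -> 'cV[R]_n) : 0 <= d ->
  (forall j, sparse k (u j)) -> (forall j j', j != j' -> dot (u j) (u j') = 0) ->
  l2norm (A *m \sum_j u j) ^+ 2
    <= \sum_j l2norm (u j) ^+ 2 + d * (\sum_j l2norm (u j)) ^+ 2.
Proof.
move=> d0 su du; rewrite mulmx_sumr l2norm_sqr dot_suml expr2 mulr_suml mulr_sumr.
rewrite -big_split/=; apply: ler_sum => i _.
rewrite dotC dot_suml mulrA !mulr_sumr (bigD1 i)//= [X in _ <= _ + X](bigD1 i)//=.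
rewrite addrA; apply: lerD.
  have s2 : sparse (2 * k) (u i) by apply: leq_trans (su i) _; rewrite leq_pmull.
  have [_] := rip s2; rewrite l2norm_sqr => /le_trans; apply.
  by rewrite mulrDl mul1r expr2 !mulrA.
apply: ler_sum => j ji; rewrite -mulrA mulrC [_ * l2norm (u j)]mulrC mulrC.
by rewrite rip_dot_le// du.
Qed.

End RIP.
End Vectors.

(** * Stable recovery *)

Section HeadBound.
Variable R : realType.

(** Write t^2 = (t^p)^(2/p-1) t^p and bound only the first factor through Q/k, the mean of the
    previous block. *)
Lemma lp_pow_tail_block (p k c Q : R) n (h : 'cV[R]_n) (B : {set 'I_n}) :
  0 < p -> p < 1 -> 0 < k -> (forall i, i \in B -> `|h i ord0| `^ p <= Q / k) ->
  \sum_(i in B) `|h i ord0| ^+ 2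
    <= k `^ (1 - 2 / p) * Q `^ (2 / p - 1) * \sum_(i in B) `|h i ord0| `^ p.
Proof.
move=> p0 p1 k0 hB; rewrite mulr_sumr; apply: ler_sum => i iB.
have q0 : 0 <= 2 / p - 1 by rewrite subr_ge0 ler_pdivlMr//; lra.
have Q0 : 0 <= Q / k by apply: le_trans (hB i iB); exact: powR_ge0.
have Q0' : 0 <= Q by move: Q0; rewrite pmulr_lge0// invr_gt0.
have -> : k `^ (1 - 2 / p) * Q `^ (2 / p - 1) = (Q / k) `^ (2 / p - 1).
  by rewrite powRM ?invr_ge0 ?(ltW k0)// powRV ?(ltW k0)// opprB mulrC.
have -> : `|h i ord0| ^+ 2 = (`|h i ord0| `^ p) `^ (2 / p - 1) * `|h i ord0| `^ p.
  rewrite -powRrM -powRD.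
    by rewrite -powR_mulrn//; congr (_ `^ _); field; rewrite gt_eqF.
  have -> : p * (2 / p - 1) + p = 2 by field; rewrite gt_eqF.
  by rewrite pnatr_eq0.
by rewrite ler_wpM2r ?powR_ge0// ge0_ler_powR ?nnegrE ?powR_ge0// hB.
Qed.

(** [sum_powR_le] raised to the power 2/p; it bounds the l2 norm of the first block from below by
    its mass. *)
Lemma sum_powR_ge (p : R) n (h : 'cV[R]_n) (B : {set 'I_n}) :
  0 < p -> p < 1 -> (0 < #|B|)%N ->
  #|B|%:R `^ (1 - 2 / p) * (\sum_(i in B) `|h i ord0| `^ p) `^ (2 / p)
    <= \sum_(i in B) `|h i ord0| ^+ 2.
Proof.
move=> p0 p1 B0; have p2 : p < 2 by lra.
have k0 : 0 < #|B|%:R :> R by rewrite ltr0n.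
set W := \sum_(i in B) _ ^+ 2.
have W0 : 0 <= W by apply: sumr_ge0 => i _; exact: sqr_ge0.
have := @sum_powR_le R _ B p (fun i => `|h i ord0|) p0 p2 (fun=> normr_ge0 _).
rewrite -/W /= => H.
have t0 : 0 <= 2 / p by rewrite divr_ge0// ltW.
apply: (@le_trans _ _ (#|B|%:R `^ (1 - 2 / p) * (#|B|%:R `^ (1 - p / 2) * W `^ (p / 2)) `^ (2 / p))).
  rewrite ler_wpM2l ?powR_ge0// ge0_ler_powR ?nnegrE// ?[0 <= _ * _]mulr_ge0 ?powR_ge0//.
  by apply: sumr_ge0 => i _; exact: powR_ge0.
rewrite powRM ?powR_ge0// -!powRrM mulrA -powRD; last first.
  by rewrite pnatr_eq0 -lt0n B0 implybT.
have -> : 1 - 2 / p + (1 - p / 2) * (2 / p) = 0 by field; rewrite gt_eqF.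
have -> : p / 2 * (2 / p) = 1 by field; rewrite gt_eqF.
by rewrite powRr0 powRr1// mul1r.
Qed.

(** Any common bound [M] of the two terms of the maximum is allowed, so that both ranges of [p] are
    treated at once. The set [T] with the first block has 2k indices, and the lower isometry bound
    is applied there. *)
Lemma rip_head_sqr_bound m n k l (A : 'M[R]_(m, n)) (d p M : R)
    (T : {set 'I_n}) (h : 'cV[R]_n) :
  (0 < k)%N -> RIP_holds A (2 * k) d -> 2^-1 <= d -> d < 1 ->
  0 < p -> p < 1 -> gfun p <= M -> 2 `^ (1 - 2 / p) <= M ->
  #|T| = k -> #|~: T| = (l.+1 * k)%N ->
  (1 - d) * \sum_(i in T) `|h i ord0| ^+ 2
    <= (Num.sqrt 2 * l2norm (A *m h)
        + Num.sqrt (k%:R `^ (1 - 2 / p) * ((2 - d) `^ (1 - 2 / p) * gfun p + 2 * d * M)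
             * (\sum_(i in ~: T) `|h i ord0| `^ p) `^ (2 / p))) ^+ 2.
Proof.
move=> k0 rip d2 d1 p0 p1 gM tM cT cTc.
have p2 : p < 2 by lra.
have k0' : 0 < k%:R :> R by rewrite ltr0n.
have [b [b_lt b_card b_ord]] := exists_block_order (fun i => `|h i ord0|) k0 cTc.
pose B j := [set i in ~: T | b i == j].
pose u j := restr (B j) h.
pose N j := l2norm (u j).
pose Q j := \sum_(i in B j) `|h i ord0| `^ p.
set P := \sum_(i in ~: T) _.
set kap := k%:R `^ (1 - 2 / p).
have kap0 : 0 <= kap by exact: powR_ge0.
have Q0 j : 0 <= Q j by apply: sumr_ge0 => i _; exact: powR_ge0.
have N0 j : 0 <= N j by exact: l2norm_ge0.
have QP : \sum_(j < l.+1) Q j = P.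
  rewrite /P (partition_big (fun i => inord (b i) : 'I_l.+1) xpredT)//=.
  apply: eq_bigr => j _; apply: eq_bigl => i; rewrite inE.
  case iT : (i \in ~: T) => //=.
  by rewrite -val_eqE/= inordK// b_lt.
(* Every entry of block [j] dominates [i], hence so does their mean. *)
have hQ j i : (j < l)%N -> i \in B j.+1 -> `|h i ord0| `^ p <= Q j / k%:R.
  move=> jl iB; rewrite ler_pdivlMr// mulr_natr -(b_card j); last by rewrite ltnS ltnW.
  rewrite -/(B j) -sumr_const; apply: ler_sum => i' i'B.
  rewrite ge0_ler_powR ?nnegrE ?(ltW p0)//.
  move: iB i'B; rewrite !inE => /andP[iT /eqP bi] /andP[iT' /eqP bi'].
  by apply: b_ord; rewrite ?inE// bi bi'.
have Bc j : (j < l.+1)%N -> #|B j| = k by exact: b_card.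
have Qdec j : (j < l)%N -> Q j.+1 <= Q j.
  move=> jl; have -> : Q j = \sum_(i in B j.+1) (Q j / k%:R).
    by rewrite sumr_const Bc// -[_ *+ k]mulr_natr divfK// gt_eqF.
  by apply: ler_sum => i; exact: hQ.
have NQ j : (j < l)%N -> N j.+1 ^+ 2 <= kap * Q j `^ (2 / p - 1) * Q j.+1.
  move=> jl; rewrite /N l2norm_restr_sqr; apply: lp_pow_tail_block => // i.
  exact: hQ.
have NQ0 : kap * Q 0 `^ (2 / p) <= N 0 ^+ 2.
  by rewrite /N l2norm_restr_sqr /kap -(Bc 0%N)//; apply: sum_powR_ge; rewrite ?Bc.
set S := \sum_(j < l) N j.+1 ^+ 2.
set G := (\sum_(j < l) N j.+1) ^+ 2.
have hS : S <= kap * Q 0 `^ (2 / p - 1) * (P - Q 0).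
  by rewrite -QP; exact: sum_sqr_le.
have hG : G <= kap * (2 * M) * P `^ (2 / p).
  by rewrite -QP; exact: sqr_sum_le_max.
have P0 : 0 <= P by rewrite -QP; exact: sumr_ge0.
have d0 : 0 <= d by lra.
have dd0 : 0 < 2 - d by lra.
have X0 : 0 <= kap * P `^ (2 / p) by rewrite mulr_ge0 ?powR_ge0.
have g0 := gfun_gt0 p0 p2.
have S1 : S <= gfun p * (kap * P `^ (2 / p)).
  apply: le_trans hS _; rewrite -mulrA [leRHS]mulrCA ler_wpM2l//.
  by have := gfun_max_hom p0 p2 ltr01 P0 (Q0 0); rewrite powR1 !mul1r.
(* Subtracting (1-d) kap Q_0^(2/p) turns the factor P - Q_0 into P - (2-d) Q_0: this is
   [gfun_max_hom] with w = 2 - d, the origin of the power of 2 - d in the constant. *)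
have S2 : S - (1 - d) * N 0 ^+ 2
    <= (2 - d) `^ (1 - 2 / p) * gfun p * (kap * P `^ (2 / p)).
  apply: (@le_trans _ _ (kap * (Q 0 `^ (2 / p - 1) * (P - (2 - d) * Q 0)))).
    have E : Q 0 `^ (2 / p) = Q 0 `^ (2 / p - 1) * Q 0.
      have q0 : 2 / p != 0 by rewrite gt_eqF// divr_gt0.
      by rewrite -{3}[Q 0]powRr1// -powRD subrK// (negbTE q0).
    have : (1 - d) * (kap * Q 0 `^ (2 / p)) <= (1 - d) * N 0 ^+ 2.
      by rewrite ler_wpM2l// subr_ge0 ltW.
    rewrite E => H; apply: le_trans (lerB hS H) _.
    by rewrite le_eqVlt; apply/orP; left; apply/eqP; ring.
  by rewrite [leRHS]mulrCA ler_wpM2l// gfun_max_hom.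
have G0 : 0 <= G by exact: sqr_ge0.
have S0 : 0 <= S by apply: sumr_ge0 => j _; exact: sqr_ge0.
pose v := \sum_(j < l) u j.+1.
have hv : l2norm (A *m v) ^+ 2 <= S + d * G.
  apply: (@rip_sum_le R m n k A d rip l (fun j => u j.+1) d0).
    by move=> j; apply: sparse_restr; rewrite Bc// ltnS.
  move=> j j' jj'; apply: dot_restr_disjoint; rewrite -setI_eq0.
  apply/eqP/setP => i; rewrite !inE; apply/negbTE.
  by apply: contra jj' => /andP[/andP[_ /eqP->] /andP[_]]; rewrite eqSS => /eqP/val_inj->.
have hE : h = restr (T :|: B 0) h + v.
  apply/matrixP => i j; rewrite (ord1 j) !mxE summxE.
  have vE : \sum_(j0 < l) u j0.+1 i ord0
      = if (i \in ~: T) && (b i != 0%N) then h i ord0 else 0.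
    case: ifPn => [/andP[iT bi]|nbi]; last first.
      apply: big1 => j0 _; rewrite mxE; case: ifP => //; rewrite inE => /andP[iT /eqP bi].
      by rewrite iT bi in nbi.
    have bl : ((b i).-1 < l)%N by rewrite -ltnS prednK ?lt0n// b_lt.
    rewrite (bigD1 (Ordinal bl))//= big1 => [|j0 jN]; rewrite mxE !inE.
      by move: iT; rewrite inE prednK ?lt0n// => ->; rewrite eqxx addr0.
    case: ifP => // /andP[_ /eqP bi']; case/eqP: jN; apply: val_inj.
    by rewrite /= bi'.
  rewrite vE !inE; case: (i \in T) => /=; first by rewrite addr0.
  by case: eqP => _ /=; rewrite ?addr0 ?add0r.
have sp : sparse (2 * k) (restr (T :|: B 0) h).
  by apply: sparse_restr; rewrite (leq_trans (leq_card_setU _ _))// cT Bc// mul2n addnn.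
have [low _] := rip _ sp.
have lowE : l2norm (restr (T :|: B 0) h) ^+ 2
    = \sum_(i in T) `|h i ord0| ^+ 2 + N 0 ^+ 2.
  rewrite l2norm_restr_sqr /N l2norm_restr_sqr.
  rewrite -bigU/=; first by apply: eq_bigl => i; rewrite !inE.
  by rewrite disjoints_subset; apply/subsetP => i iT; rewrite !inE iT.
have b_ge : l2norm (A *m restr (T :|: B 0) h)
    <= l2norm (A *m h) + Num.sqrt (S + d * G).
  have -> : A *m restr (T :|: B 0) h = A *m h + - (A *m v).
    by rewrite {2}hE mulmxDr addrK.
  apply: le_trans (l2normD_le _ _) _; rewrite l2normN lerD2l.
  by rewrite -[l2norm _]ger0_norm ?l2norm_ge0// -sqrtr_sqr ler_wsqrtr.
have SG0 : 0 <= S + d * G by rewrite addr_ge0// mulr_ge0.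
have TE : kap * ((2 - d) `^ (1 - 2 / p) * gfun p + 2 * d * M) * P `^ (2 / p)
    = ((2 - d) `^ (1 - 2 / p) * gfun p + 2 * d * M) * (kap * P `^ (2 / p)) by ring.
have dG : d * G <= d * (2 * M) * (kap * P `^ (2 / p)).
  rewrite -mulrA ler_wpM2l// (le_trans hG)// le_eqVlt; apply/orP; left.
  by apply/eqP; ring.
have M0 : 0 < M by apply: lt_le_trans gM.
have w0 : 0 <= (2 - d) `^ (1 - 2 / p) * gfun p by rewrite mulr_ge0 ?powR_ge0// ltW.
apply: (@noise_split _ _ (Num.sqrt (S + d * G)) ((1 - d) * N 0 ^+ 2)).
- exact: l2norm_ge0.
- exact: sqrtr_ge0.
- by rewrite TE mulr_ge0// addr_ge0// mulr_ge0 ?(ltW M0)// mulr_ge0.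
- rewrite -mulrDr -lowE (le_trans low)//.
  by rewrite ler_sqr ?nnegrE ?addr_ge0 ?l2norm_ge0 ?sqrtr_ge0.
- rewrite sqr_sqrtr// TE; lra.
- rewrite sqr_sqrtr// TE.
  (* Here 2d >= 1 enters: S is at most the bound 2dM kap P^(2/p) that also holds for d G, so their
     sum is at most twice the target. *)
  have gM2 : gfun p * (kap * P `^ (2 / p)) <= 2 * d * M * (kap * P `^ (2 / p)).
    by rewrite ler_wpM2r// (le_trans gM)// ler_peMl ?(ltW M0)//; lra.
  have := mulr_ge0 w0 X0; lra.
Qed.

(** Raise the squared bound to the power p/2, separate noise and tail by [powRD_le], and return to
    the p-mass on [T] by [sum_powR_le]. The resulting factor k^(1-p/2) cancels against k^(1-2/p) in
    the tail term ([XE]) and survives in the noise term. *)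
Lemma rip_head_bound m n k l (A : 'M[R]_(m, n)) (d p M : R)
    (T : {set 'I_n}) (h : 'cV[R]_n) :
  (0 < k)%N -> RIP_holds A (2 * k) d -> 2^-1 <= d -> d < 1 ->
  0 < p -> p < 1 -> gfun p <= M -> 2 `^ (1 - 2 / p) <= M ->
  #|T| = k -> #|~: T| = (l.+1 * k)%N ->
  \sum_(i in T) `|h i ord0| `^ p
    <= (((2 - d) `^ (1 - 2 / p) * gfun p + 2 * d * M) / (1 - d)) `^ (p / 2)
         * \sum_(i in ~: T) `|h i ord0| `^ p
       + k%:R `^ (1 - p / 2) * (Num.sqrt 2 * l2norm (A *m h)) `^ p
         / (1 - d) `^ (p / 2).
Proof.
move=> k0 rip d2 d1 p0 p1 gM tM cT cTc.
have p2 : p < 2 by lra.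
have := rip_head_sqr_bound h k0 rip d2 d1 p0 p1 gM tM cT cTc.
set W := \sum_(i in T) _ ^+ 2; set P := \sum_(i in ~: T) _.
set D := _ * gfun p + _; set a := Num.sqrt 2 * _.
set X := k%:R `^ (1 - 2 / p) * D * P `^ (2 / p) => H.
have a0 : 0 <= a by rewrite mulr_ge0 ?sqrtr_ge0 ?l2norm_ge0.
have W0 : 0 <= W by apply: sumr_ge0 => i _; exact: sqr_ge0.
have P0 : 0 <= P by apply: sumr_ge0 => i _; exact: powR_ge0.
have d1' : 0 < 1 - d by lra.
have D0 : 0 <= D.
  have g0 := ltW (gfun_gt0 p0 p2).
  have M0 := le_trans g0 gM.
  have d0 : 0 <= d by lra.
  by rewrite addr_ge0// mulr_ge0 ?powR_ge0// mulr_ge0.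
have t0 : 0 <= p / 2 by lra.
have kk : 0 < k%:R :> R by rewrite ltr0n.
have HW : (1 - d) `^ (p / 2) * W `^ (p / 2) <= a `^ p + X `^ (p / 2).
  rewrite -powRM ?(ltW d1')//.
  apply: (@le_trans _ _ ((a + Num.sqrt X) `^ p)).
    have -> : (a + Num.sqrt X) `^ p = ((a + Num.sqrt X) ^+ 2) `^ (p / 2).
      rewrite -powR_mulrn ?addr_ge0 ?sqrtr_ge0// -powRrM.
      by congr (_ `^ _); field.
    by rewrite ge0_ler_powR// ?nnegrE ?sqr_ge0// mulr_ge0// ltW.
  have -> : X `^ (p / 2) = Num.sqrt X `^ p.
    rewrite -powR12_sqrt; last by rewrite /X !mulr_ge0 ?powR_ge0.
    by rewrite -powRrM; congr (_ `^ _); field.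
  by apply: powRD_le => //; [exact: ltW | exact: sqrtr_ge0].
have XE : k%:R `^ (1 - p / 2) * X `^ (p / 2) = D `^ (p / 2) * P.
  rewrite /X !powRM ?mulr_ge0 ?powR_ge0// -!powRrM.
  have -> : 2 / p * (p / 2) = 1 by field; rewrite gt_eqF.
  have -> : (1 - 2 / p) * (p / 2) = - (1 - p / 2) by field; rewrite gt_eqF.
  rewrite powRr1// powRN !mulrA divff ?mul1r//.
  by rewrite gt_eqF// powR_gt0.
have := @sum_powR_le R _ T p (fun i => `|h i ord0|) p0 p2 (fun=> normr_ge0 _).
rewrite /= cT -/W => /le_trans; apply.
have dp : 0 < (1 - d) `^ (p / 2) by rewrite powR_gt0.
rewrite powRM ?invr_ge0 ?(ltW d1')// powRV ?(ltW d1')// powRN.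
rewrite [_ / _ * P]mulrAC -XE -mulrDl ler_pdivlMr// -mulrDr -mulrA.
by rewrite ler_wpM2l ?powR_ge0// [leLHS]mulrC [leRHS]addrC.
Qed.

(** Feasibility of [x] makes the p-mass of [xs] at most that of [x]. Split both over [T] and its
    complement, and use subadditivity of t^p in opposite directions: [x] against [x - xs] and [xs]
    on [T], [x - xs] against [x] and [xs] off [T]. *)
Lemma lp_minimizer_cone m n (A : 'M[R]_(m, n)) p eps y (x xs : 'cV[R]_n) (T : {set 'I_n}) :
  0 < p -> p < 1 -> is_lp_minimizer p eps A y xs -> l2norm (y - A *m x) <= eps ->
  \sum_(i in ~: T) `|(x - xs) i ord0| `^ p
    <= \sum_(i in T) `|(x - xs) i ord0| `^ p + 2 * \sum_(i in ~: T) `|x i ord0| `^ p.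
Proof.
move=> p0 p1 [_ /(_ x)] /[apply].
have L0 (z : 'cV[R]_n) : 0 <= lp_pow p z by apply: sumr_ge0 => i _; exact: powR_ge0.
rewrite /lpnorm => /(ge0_ler_powR (ltW p0)).
rewrite !nnegrE !powR_ge0 => /(_ isT isT).
rewrite -!powRrM mulVf ?gt_eqF// !powRr1// /lp_pow.
have split_sum F : \sum_i F i = \sum_(i in T) F i + \sum_(i in ~: T) F i :> R.
  by rewrite (bigID [in T])/=; congr (_ + _); apply: eq_bigl => i; rewrite inE.
rewrite !split_sum.
have tri u v w : `|u| <= `|v| + `|w| -> `|u| `^ p <= `|v| `^ p + `|w| `^ p :> R.
  move=> uvw; apply: le_trans (powRD_le p0 (ltW p1) (normr_ge0 _) (normr_ge0 _)).
  by rewrite ge0_ler_powR ?nnegrE ?addr_ge0// ltW.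
have H1 : \sum_(i in T) `|x i ord0| `^ p
    <= \sum_(i in T) `|(x - xs) i ord0| `^ p + \sum_(i in T) `|xs i ord0| `^ p.
  rewrite -big_split; apply: ler_sum => i _; apply: tri.
  by rewrite !mxE -{1}[x i ord0](subrK (xs i ord0)) ler_normD.
have H2 : \sum_(i in ~: T) `|(x - xs) i ord0| `^ p
    <= \sum_(i in ~: T) `|x i ord0| `^ p + \sum_(i in ~: T) `|xs i ord0| `^ p.
  rewrite -big_split; apply: ler_sum => i _; apply: tri.
  by rewrite !mxE ler_normB.
by move=> H; lra.
Qed.

Lemma lp_recovery m n k l (A : 'M[R]_(m, n)) (d p M eps : R) (x xs : 'cV[R]_n)
    (e y : 'cV[R]_m) (T : {set 'I_n}) :
  (0 < k)%N -> RIP_holds A (2 * k) d -> 2^-1 <= d -> d < 1 ->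
  0 < p -> p < 1 -> gfun p <= M -> 2 `^ (1 - 2 / p) <= M ->
  #|T| = k -> #|~: T| = (l.+1 * k)%N ->
  0 <= eps -> l2norm e <= eps -> y = A *m x + e -> is_lp_minimizer p eps A y xs ->
  let C := (((2 - d) `^ (1 - 2 / p) * gfun p + 2 * d * M) / (1 - d)) `^ (p / 2) in
  C < 1 ->
  lp_pow p (x - xs)
    <= 2 * (1 + C) / (1 - C) * \sum_(i in ~: T) `|x i ord0| `^ p
       + 2 `^ (3 * p / 2 + 1) / ((1 - d) `^ (p / 2) * (1 - C))
         * (k%:R `^ (1 - p / 2)) * eps `^ p.
Proof.
move=> k0 rip d2 d1 p0 p1 gM tM cT cTc e0 he hy hmin C C1.
have feas : l2norm (y - A *m x) <= eps by rewrite hy addrC addKr.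
have Ah : l2norm (A *m (x - xs)) <= 2 * eps.
  have -> : A *m (x - xs) = (y - A *m xs) + - e.
    by rewrite mulmxBr hy addrAC addrK.
  apply: le_trans (l2normD_le _ _) _; rewrite l2normN.
  by have [h _] := hmin; lra.
have cone := lp_minimizer_cone T p0 p1 hmin feas.
have head := rip_head_bound (x - xs) k0 rip d2 d1 p0 p1 gM tM cT cTc.
rewrite -/C in head.
have -> : lp_pow p (x - xs) = \sum_(i in T) `|(x - xs) i ord0| `^ p
    + \sum_(i in ~: T) `|(x - xs) i ord0| `^ p.
  by rewrite /lp_pow (bigID [in T])/=; congr (_ + _); apply: eq_bigl => i; rewrite inE.
set a := \sum_(i in T) _ in cone head *; set b := \sum_(i in ~: T) _ in cone head *.
set c := \sum_(i in ~: T) _ in cone *.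
set D := (1 - d) `^ (p / 2) in head *; set K := k%:R `^ _ in head *.
have D0 : 0 < D by rewrite powR_gt0; lra.
have K0 : 0 <= K by exact: powR_ge0.
have C0 : 0 <= C by exact: powR_ge0.
(* 2^(3p/2) is the p-th power of 2 sqrt 2: the 2 because [x] and [xs] are both within [eps] of the
   data, the sqrt 2 from [noise_split]. *)
set N := 2 `^ (3 * p / 2) * eps `^ p * K / D.
have hN : K * (Num.sqrt 2 * l2norm (A *m (x - xs))) `^ p / D <= N.
  rewrite /N ler_pM2r ?invr_gt0// mulrC ler_wpM2r//.
  have -> : 2 `^ (3 * p / 2) * eps `^ p = (Num.sqrt 2 * (2 * eps)) `^ p.
    rewrite mulrA powRM ?mulr_ge0 ?sqrtr_ge0//; congr (_ * _).
    rewrite powRM ?sqrtr_ge0// -powR12_sqrt// -powRrM -powRD; last by rewrite pnatr_eq0 implybT.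
    by congr (_ `^ _); field.
  rewrite ge0_ler_powR ?nnegrE ?(ltW p0)// ?mulr_ge0 ?sqrtr_ge0 ?l2norm_ge0//.
  by rewrite ler_wpM2l ?sqrtr_ge0.
have hab : a <= C * b + N by apply: le_trans head _; rewrite lerD2l.
have -> : 2 `^ (3 * p / 2 + 1) / (D * (1 - C)) * K * eps `^ p = 2 * N / (1 - C).
  rewrite powRD ?pnatr_eq0 ?implybT// powRr1// /N.
  by field; rewrite !gt_eqF// subr_gt0.
rewrite [_ / _ * c]mulrAC -mulrDl ler_pdivlMr ?subr_gt0//.
(* From a <= C b + N and b <= a + 2c follows (1-C) b <= 2c + N; then a + b <= (1+C) b + N. *)
nra.
Qed.

End HeadBound.

Unset Implicit Arguments. Set Strict Implicit.
Theorem theorem1 (R : realType) (pstar : R)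
  (hpstar : [/\ 0 < pstar, pstar <= 1, ffun_p pstar = 1 &
             forall q : R, 0 < q -> q <= 1 -> ffun_p q = 1 -> q = pstar])
  (k l m : nat) (hk : (0 < k)%N) (hl : (0 < l)%N) (hm : (0 < m)%N)
  (A : 'M[R]_(m, (l.+1 * k)%N)) (delta : R)
  (hdelta : is_RIC A (2 * k)%N delta)
  (hdlo : Num.sqrt 2 / 2 <= delta) (hdhi : delta < 1)
  (x : 'cV[R]_(l.+1 * k)%N) (eps : R) (heps : 0 <= eps)
  (e : 'cV[R]_m) (he : l2norm e <= eps) (y : 'cV[R]_m) (hy : y = A *m x + e)
  (p : R) (hp0 : 0 < p) (hp1 : p < 1) (hC : Cconst pstar delta p < 1)
  (xs : 'cV[R]_(l.+1 * k)%N) (hxs : is_lp_minimizer p eps A y xs) :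
  let C := Cconst pstar delta p in
  let C0 := 2 * (1 + C) / (1 - C) in
  let C1 := 2 `^ (3 * p / 2 + 1) / ((1 - delta) `^ (p / 2) * (1 - C)) in
  lp_pow p (x - xs) <= C0 * lp_pow p (restr_tail k x)
                       + C1 * (k%:R `^ (1 - p / 2)) * eps `^ p
  /\ (eps = 0 -> sparse k x -> xs = x).
Proof.
case: hpstar => ps0 ps1 fps _; case: hdelta => rip _.
have d2 : 2^-1 <= delta.
  apply: le_trans hdlo; rewrite -[leLHS]mul1r ler_pM2r ?invr_gt0//.
  by rewrite -[leLHS]sqrtr1 ler_wsqrtr// ler1n.
(* The larger of the two terms on each side of [pstar]; with it both cases of [Cconst] take the form
   used in [lp_recovery]. *)
pose M := if p <= pstar then gfun p else 2 `^ (1 - 2 / p).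
have gM : gfun p <= M.
  by rewrite /M; case: (leP p pstar) => // h; apply: (@gfun_le_of_ffun_p_eq1 _ _ pstar) => //; exact: ltW.
have tM : 2 `^ (1 - 2 / p) <= M.
  by rewrite /M; case: ifP => // h; apply: (@gfun_ge_of_ffun_p_eq1 _ _ pstar).
have CE : Cconst pstar delta p
    = (((2 - delta) `^ (1 - 2 / p) * gfun p + 2 * delta * M) / (1 - delta)) `^ (p / 2).
  rewrite /Cconst /M; case: ifP => _; congr ((_ / _) `^ _); first by rewrite mulrDl.
  have -> : 2 - 2 / p = 1 + (1 - 2 / p) by ring.
  rewrite [2 `^ (1 + _)]powRD ?pnatr_eq0 ?implybT// powRr1//.
  by congr (_ + _); ring.
(* Stated for every [T] of size [k]: the estimate takes the first [k] indices, exact recovery a set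
   containing the support of [x]. *)
have main (T : {set 'I_(l.+1 * k)}) : #|T| = k ->
    lp_pow p (x - xs)
    <= 2 * (1 + Cconst pstar delta p) / (1 - Cconst pstar delta p)
         * \sum_(i in ~: T) `|x i ord0| `^ p
       + 2 `^ (3 * p / 2 + 1) / ((1 - delta) `^ (p / 2) * (1 - Cconst pstar delta p))
         * (k%:R `^ (1 - p / 2)) * eps `^ p.
  move=> cT; rewrite CE in hC *.
  (* Writing [l] as a successor shows that the complement of [T] consists of at least one full
     block. *)
  case: l hl T cT => // l' _ T cT in A rip x y hy xs hxs *.
  have cTc : #|~: T| = (l'.+1 * k)%N by rewrite cardsCs setCK card_ord cT mulSn addKn.
  exact: (lp_recovery hk rip d2 hdhi hp0 hp1 gM tM cT cTc heps he hy hxs).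
split.
  have kn : (k <= l.+1 * k)%N by rewrite leq_pmull.
  have cT : #|[set i : 'I_(l.+1 * k) | (i < k)%N]| = k.
    have winj : injective (widen_ord kn) by move=> i j /(congr1 (@nat_of_ord _)) /= /ord_inj.
    rewrite -[RHS]card_ord -(card_imset _ winj); apply: eq_card => i.
    rewrite inE; apply/idP/imsetP => [ik|[j _ ->]]; last exact: (ltn_ord j).
    by exists (Ordinal ik) => //; exact: val_inj.
  have := main _ cT; congr (_ <= _ * _ + _).
  rewrite /lp_pow big_mkcond; apply: eq_bigr => i _; rewrite !inE mxE -leqNgt.
  (* The zeros of [restr_tail] contribute nothing, as 0^p = 0 for nonzero [p]. *)
  by case: ifP => // _; rewrite normr0 powR0// gt_eqF.
move=> eps0 sx.
have kn : (k <= #|'I_(l.+1 * k)|)%N by rewrite card_ord leq_pmull.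
have [T suppT cT] := exists_superset_card sx kn.
(* Noise and tail terms both vanish, so the p-mass of [x - xs] is at most 0. *)
have := main _ cT; rewrite eps0 powR0 ?gt_eqF// mulr0 addr0 big1 ?mulr0 => [|i iT]; last first.
  have /eqP -> : x i ord0 == 0.
    by apply: contraTT iT => xi; rewrite inE negbK (subsetP suppT)// inE.
  by rewrite normr0 powR0// gt_eqF.
move=> le0; have : lp_pow p (x - xs) == 0.
  by rewrite eq_le le0 sumr_ge0// => i _; exact: powR_ge0.
rewrite psumr_eq0 => [/allP h|i _]; last exact: powR_ge0.
apply/matrixP => i j; rewrite (ord1 j); apply/eqP; rewrite eq_sym -subr_eq0.
by have := h i (mem_index_enum _); rewrite powR_eq0 normr_eq0 !mxE => /andP[].
Qed.
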